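(* Let $s\ge1$ and let $b_i,a_{ij}$ ($i,j=1,\dots,s$) be the real coefficients of a diagonally implicit Runge--Kutta method, i.e. $a_{ij}=0$ for $j>i$. If $a_{ii}>0$ for all $i=1,\dots,s$, then the fully discrete scheme derived by applying the Fourier pseudo-spectral method in space to the $s$-stage LEQRK scheme is uniquely solvable; that is, for every $\Delta t>0$ and all given grid functions $\Phi^n,q^n$ and $\Phi_N(t_n+c_i\Delta t)$, $i=1,\dots,s$, the linear system for the stage values $(\Phi_i^n,Q_i^n,k_i^n,l_i^n)_{i=1}^s$ has exactly one solution (and hence $(\Phi^{n+1},q^{n+1})$ is uniquely determined).
   Context: Model. $\Phi=(\phi_1,\dots,\phi_d)^T$ is a $d$-component state variable on a domain $\Omega$ with periodic boundary conditions. The gradient flow is $\partial_t\Phi=\mathcal{G}\,\frac{\delta F}{\delta\Phi}$ with $F=\frac12(\Phi,\mathcal{L}\Phi)+(f(\Phi,\nabla\Phi),1)$, where $\mathcal{L}$ is linear, self-adjoint, positive semi-definite and independent of $\Phi$ (written $\mathcal{L}=\mathcal{A}^*\mathcal{A}$ with $\mathcal{A}$ linear), the mobility operator $\mathcal{G}$ is negative semi-definite, and $f$ is bounded below. $C>0$ is a constant such that $f+C>0$, and $g[\Phi]=\sqrt{f(\Phi,\nabla\Phi)+C}$. $\frac{\partial g}{\partial\Phi}$ and $\frac{\partial g}{\partial\nabla\Phi}$ denote the partial derivatives of $g$ with respect to $\Phi$ and $\nabla\Phi$. The symbol $\cdot$ denotes full contraction over component (and derivative) indices, and $\nabla\cdot(2Q\frac{\partial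 g}{\partial\nabla\Phi})$ is the $d$-vector obtained by taking the divergence componentwise. Spatial discretization. Functions are replaced by real grid functions on a uniform periodic grid, products are pointwise, the inner product is the discrete one $(u,v)=|\text{cell}|\sum_{\text{grid points}}u\cdot v$, and $\nabla$, $\nabla\cdot$, $\mathcal{L}$, $\mathcal{G}$, $\mathcal{A}$ denote (with the same symbols) the corresponding discrete Fourier pseudo-spectral operators, which are linear operators on grid functions. The discrete operators inherit the structure of the continuous ones: discrete integration by parts $(\nabla u,\mathbf v)=-(u,\nabla\cdot\mathbf v)$ holds, $\mathcal{L}=\mathcal{A}^*\mathcal{A}$ (adjoint with respect to the discrete inner product), and $(v,\mathcal{G}v)\le0$ for all $v$. $\mathcal{G}$ is a linear operator that does not depend on the unknown stage values. $s$-stage LEQRK scheme. Let $c_i=\sum_{j=1}^s a_{ij}$, $t_n=n\Delta t$. Given $(\Phi^n,q^n)$ and given (already known) values $\Phi_N(t_n+c_i\Delta t)$, put $$\Big(\tfrac{\partial g}{\partial\Phi}\Big)_i^{n,*}=\tfrac{\partial g}{\partial\Phi}[\Phi_N(t_n+c_i\Delta t)],\qquad \Big(\tfrac{\partial g}{\partial\nabla\Phi}\Big)_i^{n,*}=\tfrac{\partial g}{\partial\nabla\Phi}[\Phi_N(t_n+c_i\Delta t)].$$ The unknown stage values satisfy, for $i=1,\dots,s$, $$\Phi_i^n=\Phi^n+\Delta t\sum_{j=1}^s a_{ij}k_j^n,\qquad Q_i^n=q^n+\Delta t\sum_{j=1}^s a_{ij}l_j^n,$$ $$k_i^n=\mathcal{G}\Big(\mathcal{L}\Phi_i^n+2Q_i^n\Big(\tfrac{\partial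 g}{\partial\Phi}\Big)_i^{n,*}-\nabla\cdot\Big(2Q_i^n\Big(\tfrac{\partial g}{\partial\nabla\Phi}\Big)_i^{n,*}\Big)\Big),$$ $$l_i^n=\Big(\tfrac{\partial g}{\partial\Phi}\Big)_i^{n,*}\cdot k_i^n+\Big(\tfrac{\partial g}{\partial\nabla\Phi}\Big)_i^{n,*}\cdot\nabla k_i^n,$$ and then $\Phi^{n+1}=\Phi^n+\Delta t\sum_{i=1}^s b_ik_i^n$, $q^{n+1}=q^n+\Delta t\sum_{i=1}^s b_il_i^n$. *)

(* Defs.v *)
From HB Require Import structures.
From mathcomp Require Import all_boot all_order all_algebra.
From mathcomp Require Import all_classical all_reals all_analysis.
Set Implicit Arguments.
Unset Strict Implicit.
Unset Printing Implicit Defensive.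
Import Order.TTheory GRing.Theory Num.Theory.
Import numFieldNormedType.Exports.
Local Open Scope classical_set_scope.
Local Open Scope ring_scope.

(* The domain is the periodic box [0, len 0) x ... x [0, len (m-1)), with N k   *)
(* grid points in direction k; p : grid N stands for the point whose k-th       *)
(* coordinate is (p k) * len k / N k.                                           *)
Definition grid (m : nat) (N : 'I_m -> nat) : finType :=
  {dffun forall k : 'I_m, 'I_(N k)}.

Notation gridfun N T := {ffun grid N -> T}.

Section FourierPseudoSpectral.
Variable R : realType.

(* The trigonometric cardinal function of n equispaced points on a period len,  *)
(*   (1/n) * \sum_(-n/2 <= xi <= n/2) c_xi^-1 e^(2 i pi xi x / len),            *)
(* with c_xi = 2 if |xi| = n/2 and c_xi = 1 otherwise, in real form. It is 1 at *)
(* x = 0 and 0 at the other nodes.                                              *)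
Definition trig_cardinal (n : nat) (len x : R) : R :=
  n%:R^-1 * (1 + \sum_(1 <= xi < n./2.+1)
     (if xi.*2 == n then 1 else 2) * cos (xi%:R * (2 * pi / len) * x)).

Definition node (n : nat) (len : R) (j : 'I_n) : R := j%:R * (len / n%:R).

Definition fourier_diff (n : nat) (len : R) : 'M[R]_n :=
  \matrix_(i, j) derive1 (fun x => trig_cardinal n len (x - node len j)) (node len i).

Variables (m : nat) (N : 'I_m -> nat) (len : 'I_m -> R).

Definition same_line (k : 'I_m) (p q : grid N) : bool :=
  [forall l : 'I_m, (l != k) ==> (q l == p l)].

Definition dpart (k : 'I_m) (u : gridfun N R) : gridfun N R :=
  [ffun p => \sum_(q | same_line k p q) fourier_diff (N k) (len k) (p k) (q k) * u q].

Definition dgrad (d : nat) (u : gridfun N 'cV[R]_d) : gridfun N 'M[R]_(d, m) :=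
  [ffun p => \matrix_(i, k) dpart k [ffun q => u q i ord0] p].

Definition ddiv (d : nat) (v : gridfun N 'M[R]_(d, m)) : gridfun N 'cV[R]_d :=
  [ffun p => \col_i \sum_k dpart k [ffun q => v q i k] p].

Definition contract (d1 d2 : nat) (A B : 'M[R]_(d1, d2)) : R :=
  \sum_i \sum_j A i j * B i j.

Definition dinner (d1 d2 : nat) (u v : gridfun N 'M[R]_(d1, d2)) : R :=
  (\prod_k (len k / (N k)%:R)) * \sum_p contract (u p) (v p).

Definition pcontract (d1 d2 : nat) (u v : gridfun N 'M[R]_(d1, d2)) : gridfun N R :=
  [ffun p => contract (u p) (v p)].

Definition pscale (d1 d2 : nat) (Q : gridfun N R) (u : gridfun N 'M[R]_(d1, d2)) :
    gridfun N 'M[R]_(d1, d2) :=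
  [ffun p => Q p *: u p].

Section Scheme.
Variable d : nat.
Variables (f : 'cV[R]_d -> 'M[R]_(d, m) -> R) (C : R).

Definition gfun (y : 'cV[R]_d) (z : 'M[R]_(d, m)) : R := Num.sqrt (f y z + C).

Definition dg_dPhi (Phi : gridfun N 'cV[R]_d) : gridfun N 'cV[R]_d :=
  [ffun p => \col_i 'D_(delta_mx i ord0) (fun y => gfun y (dgrad Phi p)) (Phi p)].

Definition dg_dgradPhi (Phi : gridfun N 'cV[R]_d) : gridfun N 'M[R]_(d, m) :=
  [ffun p => \matrix_(i, k) 'D_(delta_mx i k) (gfun (Phi p)) (dgrad Phi p)].

Record stage_values (s : nat) := StageValues {
  stPhi : {ffun 'I_s -> gridfun N 'cV[R]_d};
  stQ : {ffun 'I_s -> gridfun N R};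
  stk : {ffun 'I_s -> gridfun N 'cV[R]_d};
  stl : {ffun 'I_s -> gridfun N R}
}.

Variables (Lop Gop : gridfun N 'cV[R]_d -> gridfun N 'cV[R]_d).
Variables (s : nat) (a : 'M[R]_s) (b : 'I_s -> R) (dt : R) (n : nat).
Variable PhiN : R -> gridfun N 'cV[R]_d.
Variables (Phin : gridfun N 'cV[R]_d) (qn : gridfun N R).

Definition stage_time (i : 'I_s) : R := n%:R * dt + (\sum_j a i j) * dt.

Definition leqrk_stages (st : stage_values s) : Prop :=
  forall i : 'I_s,
    let gP := dg_dPhi (PhiN (stage_time i)) in
    let gD := dg_dgradPhi (PhiN (stage_time i)) in
    [/\ stPhi st i = Phin + dt *: \sum_j a i j *: stk st j,
        stQ st i = qn + dt *: \sum_j a i j *: stl st j,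
        stk st i = Gop (Lop (stPhi st i) + pscale (2 *: stQ st i) gP
                        - ddiv (pscale (2 *: stQ st i) gD))
      & stl st i = pcontract gP (stk st i) + pcontract gD (dgrad (stk st i))].

Definition leqrk_step (X : gridfun N 'cV[R]_d * gridfun N R) : Prop :=
  exists st : stage_values s,
    [/\ leqrk_stages st,
        X.1 = Phin + dt *: \sum_i b i *: stk st i
      & X.2 = qn + dt *: \sum_i b i *: stl st i].

End Scheme.
End FourierPseudoSpectral.

(* Main.v *)
Require Import Defs.
From HB Require Import structures.
From mathcomp Require Import all_boot all_order all_algebra.
From mathcomp Require Import all_classical all_reals all_analysis.
Import Order.TTheory GRing.Theory Num.Theory.
Import numFieldNormedType.Exports.
Local Open Scope ring_scope.

(** Eliminating the [Phi_i] and [Q_i], which are affine in the slopes, and the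
    [l_i = B_i k_i] leaves a square affine system for [k_1, ..., k_s] alone:
    here [B_i] is the linear map [coupling], which pairs a variation of the
    state with the partial derivatives of [g] extrapolated at stage [i]. Grid
    functions form a finite-dimensional space, so it suffices that the
    homogeneous system has only the zero solution
    ([linear_bijective_exists_unique]).

    Since the method is diagonally implicit, the homogeneous system is solved
    one stage at a time ([stage_residual_inj]), and every stage has the form
    [k = G w] with [w = h (A^* A k + 2 B^* B k)] and [h = dt a_ii > 0]. This is
    where the energy structure of the scheme enters. Discrete integration by
    parts says that the operator acting on [Q_i] in the equation for [k_i] is
    exactly the adjoint [B^*] of the map [B] defining [l_i]
    ([dinner_coupling_adj]), hence
      [0 >= (w, G w) = (w, k) = h (|A k|^2 + 2 |B k|^2)].
    So [A k = 0] and [B k = 0] ([one_stage_homogeneous]), then [w = 0], and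
    finally [k = G 0 = 0], even when [A^* A + 2 B^* B] has a kernel.

    Integration by parts rests on the skew-symmetry of the Fourier
    differentiation matrix ([fourier_diff_skew]): the trigonometric cardinal
    function is even, so its derivative is odd. *)

Set Implicit Arguments.
Unset Strict Implicit.

(** * Diagonally implicit systems in finite dimension *)

Lemma linear_bijective_exists_unique (F : fieldType) (V : vectType F)
    (T : {linear V -> V}) (c : V) :
  (forall x, T x = 0 -> x = 0) -> exists! x, T x = c.
Proof.
move=> T_inj.
have kerT : lker (linfun T) == 0%VS.
  rewrite -subv0; apply/subvP => x; rewrite memv_ker lfunE memv0 => /eqP Tx0.
  by apply/eqP/T_inj.
exists ((linfun T)^-1%VF c); split.
  by rewrite -[LHS](lfunE T) /= lker0_lfunVK.
by move=> x <-; rewrite -[T x](lfunE T) lker0_lfunK.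
Qed.

Section DiagonallyImplicit.
Variables (F : realFieldType) (V : vectType F) (W : lmodType F).
Variables (s : nat) (a : 'M[F]_s) (dt : F).
Variables (G L : {linear V -> V}).
Variables (B : 'I_s -> {linear V -> W}) (Bt : 'I_s -> {linear W -> V}).

(** The right-hand side of the [i]-th slope equation at stage values [x] for the
    state and [y] for the auxiliary variable. *)
Definition stage_slope (i : 'I_s) (x : V) (y : W) : V := G (L x + Bt i (2 *: y)).

Definition slope_sum (U : lmodType F) (i : 'I_s) (k : 'I_s -> U) : U :=
  dt *: \sum_j a i j *: k j.

(** The homogeneous part of the slope equations, with the stage values and the
    auxiliary slopes [B j (K j)] eliminated. *)
Definition stage_residual (K : {ffun 'I_s -> V}) : {ffun 'I_s -> V} :=
  [ffun i => K i - stage_slope i (slope_sum i K)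
                               (slope_sum i (fun j => B j (K j)))].

Lemma stage_slopeP i c x x' y y' :
  stage_slope i (c *: x + x') (c *: y + y') =
  c *: stage_slope i x y + stage_slope i x' y'.
Proof.
rewrite /stage_slope scalerDr !scalerA [2 * c]mulrC -scalerA !linearP addrACA.
by rewrite -scalerDr linearP.
Qed.

Lemma slope_sumP (U : lmodType F) i c (k k' : 'I_s -> U) :
  slope_sum i (fun j => c *: k j + k' j) =
  c *: slope_sum i k + slope_sum i k'.
Proof.
rewrite /slope_sum scalerA mulrC -scalerA -scalerDr; congr (_ *: _).
rewrite scaler_sumr -big_split; apply: eq_bigr => j _ /=.
by rewrite scalerDr !scalerA [a i j * c]mulrC.
Qed.

Lemma stage_residual_linear : linear stage_residual.
Proof.
move=> c K K'; apply/ffunP => i; rewrite !ffunE.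
have -> : slope_sum i (c *: K + K') = c *: slope_sum i K + slope_sum i K'.
  by rewrite -slope_sumP; congr (_ *: _); apply: eq_bigr => j _; rewrite !ffunE.
have -> : slope_sum i (fun j => B j ((c *: K + K') j)) =
    c *: slope_sum i (fun j => B j (K j)) + slope_sum i (fun j => B j (K' j)).
  by rewrite -slope_sumP; congr (_ *: _); apply: eq_bigr => j _; rewrite !ffunE linearP.
by rewrite stage_slopeP opprD addrACA -scalerBr.
Qed.

HB.instance Definition _ :=
  GRing.isLinear.Build F {ffun 'I_s -> V} {ffun 'I_s -> V} *:%R stage_residual
    stage_residual_linear.

Hypothesis a_dirk : forall i j : 'I_s, (i < j)%N -> a i j = 0.
Hypothesis a_diag_gt0 : forall i : 'I_s, 0 < a i i.
Hypothesis dt_gt0 : 0 < dt.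
Hypothesis one_stage : forall i h k,
  0 < h -> k = stage_slope i (h *: k) (h *: B i k) -> k = 0.

(** The stages decouple from the first one on: once the earlier slopes vanish,
    the [i]-th equation involves the [i]-th slope alone, with step
    [dt * a i i > 0]. *)
Lemma stage_residual_inj K : stage_residual K = 0 -> K = 0.
Proof.
move=> TK0; apply/ffunP => i; rewrite [RHS]ffunE.
have [n lt_in] := ubnP (i : nat); elim: n => // n IHn in i lt_in *.
have diag (U : lmodType F) (k : 'I_s -> U) : (forall j, K j = 0 -> k j = 0) ->
    slope_sum i k = (dt * a i i) *: k i.
  move=> k0; rewrite /slope_sum (bigD1 i) //= big1 ?addr0 ?scalerA // => j ne_ji.
  have [lt_ij|] := ltnP i j; first by rewrite a_dirk ?scale0r.
  rewrite leq_eqVlt (inj_eq val_inj) (negbTE ne_ji) /= => lt_ji.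
  by rewrite k0 ?scaler0 // IHn // (leq_trans lt_ji).
move/ffunP/(_ i): TK0; rewrite !ffunE => /eqP; rewrite subr_eq0 => /eqP.
rewrite !diag // => [|j ->]; last by rewrite linear0.
by apply: one_stage; rewrite mulr_gt0.
Qed.

(** The equations say that the linear map [stage_residual] takes a prescribed
    value at [K]; in finite dimension its injectivity is enough. *)
Lemma dirk_exists_unique (p : V) (q : W) :
  exists! K : {ffun 'I_s -> V}, forall i,
    K i = stage_slope i (p + slope_sum i K)
                        (q + slope_sum i (fun j => B j (K j))).
Proof.
pose c := [ffun i => stage_slope i p q].
have stageE K : stage_residual K = c <-> forall i, K i =
    stage_slope i (p + slope_sum i K) (q + slope_sum i (fun j => B j (K j))).
  have splitE i : stage_slope i (p + slope_sum i K)
      (q + slope_sum i (fun j => B j (K j))) = c i +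
      stage_slope i (slope_sum i K) (slope_sum i (fun j => B j (K j))).
    by have := stage_slopeP i 1 p (slope_sum i K) q; rewrite !scale1r ffunE => ->.
  split=> [/ffunP TKc i|Keq].
    by rewrite splitE -TKc ffunE subrK.
  by apply/ffunP => i; rewrite ffunE {1}Keq splitE addrK.
have [K [TK uK]] := linear_bijective_exists_unique c stage_residual_inj.
by exists K; split=> [|K' /stageE]; [apply/stageE|apply: uK].
Qed.

End DiagonallyImplicit.

(** * Skew-symmetry of Fourier differentiation *)

Section FourierDifferentiation.
Variable R : realType.

Lemma derive1_even (f : R -> R) (x : R) :
  (forall y, derivable f y 1) -> (forall y, f (- y) = f y) ->
  derive1 f (- x) = - derive1 f x.
Proof.
move=> df f_even; have fE : f = f \o -%R by apply/funext => y; rewrite /= f_even.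
rewrite [in RHS]fE [in RHS]derive1_comp //.
by rewrite [derive1 -%R x]derive1E derive_val mulrN1 opprK.
Qed.

Lemma derivable_trig_cardinal n (len x : R) :
  derivable (trig_cardinal n len) x 1.
Proof.
apply: derivableM => //; apply: derivableD => //.
rewrite /index_iota; elim: (iota _ _) => [|xi r IHr].
  by under eq_fun do rewrite big_nil; exact: derivable_cst.
under eq_fun do rewrite big_cons.
by apply: derivableD => //; apply: derivableM.
Qed.

Lemma trig_cardinal_even n (len x : R) :
  trig_cardinal n len (- x) = trig_cardinal n len x.
Proof.
by congr (_ * (1 + _)); apply: eq_bigr => xi _; rewrite mulrN cosN.
Qed.

Lemma fourier_diffE n (len : R) (i j : 'I_n) :
  fourier_diff n len i j =
  derive1 (trig_cardinal n len) (node len i - node len j).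
Proof.
by rewrite mxE /derive1; under eq_fun do rewrite -addrA.
Qed.

(** The cardinal function is even, so its derivative is odd, and the entry
    [(i, j)] only depends on the difference of the two nodes. *)
Lemma fourier_diff_skew n (len : R) (i j : 'I_n) :
  fourier_diff n len i j = - fourier_diff n len j i.
Proof.
rewrite !fourier_diffE -opprB derive1_even //.
  exact: derivable_trig_cardinal.
exact: trig_cardinal_even.
Qed.

End FourierDifferentiation.

(** * The discrete inner product and integration by parts *)

Section DiscreteCalculus.
Variables (R : realType) (m : nat) (N : 'I_m -> nat) (len : 'I_m -> R).

Definition cell_volume : R := \prod_k (len k / (N k)%:R).

(* The unqualified name denotes the contraction of the extended real line. *)
Local Notation contract := Defs.contract.

Lemma same_lineC k (p q : grid N) : same_line k p q = same_line k q p.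
Proof. by apply: eq_forallb => l; rewrite [p l == _]eq_sym. Qed.

Lemma dpart_linear k : linear (dpart (N := N) len k).
Proof.
move=> c u v; apply/ffunP => p; rewrite !ffunE scaler_sumr -big_split.
apply: eq_bigr => q _; rewrite !ffunE /= mulrDr; congr (_ + _).
by rewrite /GRing.scale /= mulrCA.
Qed.

HB.instance Definition _ k :=
  GRing.isLinear.Build R (gridfun N R) (gridfun N R) *:%R (dpart len k)
    (dpart_linear k).

(** Only the values on the line through a point in direction [k] enter the
    derivative there; exchanging the two sums transposes the differentiation
    matrix. *)
Lemma dpart_skew k (u v : gridfun N R) :
  \sum_p dpart len k u p * v p = - \sum_p u p * dpart len k v p.
Proof.
under eq_bigr do rewrite ffunE mulr_suml.
under [in RHS]eq_bigr do rewrite ffunE mulr_sumr.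
rewrite (exchange_big_dep xpredT) //= -sumrN; apply: eq_bigr => q _.
rewrite -sumrN; apply: eq_big => [p|p _]; first exact: same_lineC.
by rewrite fourier_diff_skew !mulNr mulrCA mulrA.
Qed.

Lemma dgrad_linear d : linear (dgrad (N := N) len (d := d)).
Proof.
move=> c u v; apply/ffunP => p; apply/matrixP => i k.
rewrite !ffunE !mxE.
have -> : [ffun q => (c *: u + v) q i ord0] =
    c *: [ffun q => u q i ord0] + [ffun q => v q i ord0] :> gridfun N R.
  by apply/ffunP => q; rewrite !ffunE !mxE.
by rewrite linearP !ffunE.
Qed.

HB.instance Definition _ d :=
  GRing.isLinear.Build R (gridfun N 'cV[R]_d) (gridfun N 'M[R]_(d, m)) *:%R
    (dgrad len (d := d)) (@dgrad_linear d).

Lemma ddiv_linear d : linear (ddiv (N := N) len (d := d)).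
Proof.
move=> c u v; apply/ffunP => p; apply/colP => i.
rewrite !ffunE !mxE mulr_sumr -big_split; apply: eq_bigr => k _ /=.
have -> : [ffun q => (c *: u + v) q i k] =
    c *: [ffun q => u q i k] + [ffun q => v q i k] :> gridfun N R.
  by apply/ffunP => q; rewrite !ffunE !mxE.
by rewrite linearP !ffunE.
Qed.

HB.instance Definition _ d :=
  GRing.isLinear.Build R (gridfun N 'M[R]_(d, m)) (gridfun N 'cV[R]_d) *:%R
    (ddiv len (d := d)) (@ddiv_linear d).

Lemma contract_linear d1 d2 (A : 'M[R]_(d1, d2)) c B B' :
  contract A (c *: B + B') = c * contract A B + contract A B'.
Proof.
rewrite /contract mulr_sumr -big_split; apply: eq_bigr => i _ /=.
rewrite mulr_sumr -big_split; apply: eq_bigr => j _ /=.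
by rewrite !mxE mulrDr mulrCA.
Qed.

Lemma contractC d1 d2 (A B : 'M[R]_(d1, d2)) : contract A B = contract B A.
Proof. by apply: eq_bigr => i _; apply: eq_bigr => j _; rewrite mulrC. Qed.

Lemma contract_ge0 d1 d2 (A : 'M[R]_(d1, d2)) : 0 <= contract A A.
Proof. by do 2! [apply: sumr_ge0 => ? _]; rewrite -expr2 sqr_ge0. Qed.

Lemma contract_eq0 d1 d2 (A : 'M[R]_(d1, d2)) : contract A A = 0 -> A = 0.
Proof.
move/eqP; rewrite psumr_eq0 => [|i _]; last first.
  by apply: sumr_ge0 => j _; rewrite -expr2 sqr_ge0.
move/allP => A0; apply/matrixP => i j; rewrite [RHS]mxE; apply/eqP.
have /implyP/(_ isT) := A0 i (mem_index_enum i).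
rewrite psumr_eq0 => [/allP/(_ j (mem_index_enum j))|? _]; last by rewrite -expr2 sqr_ge0.
by rewrite /= mulf_eq0 orbb.
Qed.

Lemma dinner_linear d1 d2 (u : gridfun N 'M[R]_(d1, d2)) :
  linear (dinner len u : _ -> R^o).
Proof.
move=> c v w; rewrite /dinner /GRing.scale /= mulrCA -mulrDr; congr (_ * _).
rewrite mulr_sumr -big_split; apply: eq_bigr => p _.
by rewrite !ffunE contract_linear.
Qed.

HB.instance Definition _ d1 d2 (u : gridfun N 'M[R]_(d1, d2)) :=
  GRing.isLinear.Build R (gridfun N 'M[R]_(d1, d2)) R^o *:%R
    (dinner len u) (dinner_linear u).

Lemma dinnerC d1 d2 (u v : gridfun N 'M[R]_(d1, d2)) :
  dinner len u v = dinner len v u.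
Proof. by congr (_ * _); apply: eq_bigr => p _; rewrite contractC. Qed.

(** Entry by entry and direction by direction this is the skew-symmetry of the
    differentiation matrices. *)
Lemma dinner_ddiv d (u : gridfun N 'cV[R]_d) (v : gridfun N 'M[R]_(d, m)) :
  dinner len u (ddiv len v) = - dinner len (dgrad len u) v.
Proof.
rewrite /dinner -mulrN; congr (_ * _); rewrite /contract.
rewrite exchange_big [in RHS]exchange_big -sumrN; apply: eq_bigr => i _ /=.
rewrite [in RHS]exchange_big -sumrN /=.
under eq_bigr do rewrite big_ord1 ffunE mxE mulr_sumr.
rewrite exchange_big; apply: eq_bigr => k _ /=.
under [in RHS]eq_bigr do rewrite ffunE mxE.
have := dpart_skew k [ffun q => u q i ord0] [ffun q => v q i k].
move=> /(congr1 -%R); rewrite opprK => skew.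
transitivity (\sum_p [ffun q => u q i ord0] p * dpart len k [ffun q => v q i k] p).
  by apply: eq_bigr => p _; rewrite [in RHS]ffunE.
by rewrite -skew; congr (- _); apply: eq_bigr => p _; rewrite [X in _ * X]ffunE.
Qed.

(** * The linearization of the energy density and its adjoint *)

Section Coupling.
Variable d : nat.
Variables (gP : gridfun N 'cV[R]_d) (gD : gridfun N 'M[R]_(d, m)).

Definition coupling (u : gridfun N 'cV[R]_d) : gridfun N R :=
  pcontract gP u + pcontract gD (dgrad len u).

Definition coupling_adj (Q : gridfun N R) : gridfun N 'cV[R]_d :=
  pscale Q gP - ddiv len (pscale Q gD).

Lemma coupling_linear : linear coupling.
Proof.
move=> c u v; apply/ffunP => p.
rewrite /coupling linearP !ffunE !contract_linear.
by rewrite /GRing.scale /= mulrDr addrACA.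
Qed.

HB.instance Definition _ :=
  GRing.isLinear.Build R (gridfun N 'cV[R]_d) (gridfun N R) *:%R coupling
    coupling_linear.

Lemma pscale_linear d1 d2 (w : gridfun N 'M[R]_(d1, d2)) c Q Q' :
  pscale (c *: Q + Q') w = c *: pscale Q w + pscale Q' w.
Proof. by apply/ffunP => p; rewrite !ffunE scalerDl scalerA. Qed.

Lemma coupling_adj_linear : linear coupling_adj.
Proof.
move=> c Q Q'.
by rewrite /coupling_adj !pscale_linear linearP opprD addrACA -scalerBr.
Qed.

HB.instance Definition _ :=
  GRing.isLinear.Build R (gridfun N R) (gridfun N 'cV[R]_d) *:%R coupling_adj
    coupling_adj_linear.

(** [coupling_adj] is the adjoint of [coupling]: the divergence term is what
    integration by parts makes of the gradient in [coupling]. *)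
Lemma dinner_coupling_adj u Q :
  dinner len u (coupling_adj Q) = cell_volume * \sum_p Q p * coupling u p.
Proof.
rewrite linearB /= dinner_ddiv opprK /dinner -mulrDr -big_split /=.
congr (_ * _); apply: eq_bigr => p _.
have scaleE d1 d2 (x y : 'M[R]_(d1, d2)) : contract x (Q p *: y) = Q p * contract y x.
  by rewrite contractC /contract mulr_sumr; apply: eq_bigr => i _;
    rewrite mulr_sumr; apply: eq_bigr => j _; rewrite mxE mulrA.
by rewrite !ffunE !scaleE mulrDr.
Qed.

End Coupling.

Hypothesis N_gt0 : forall k, (0 < N k)%N.
Hypothesis len_gt0 : forall k, 0 < len k.

Lemma cell_volume_gt0 : 0 < cell_volume.
Proof. by apply: prodr_gt0 => k _; rewrite divr_gt0 ?ltr0n. Qed.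

Lemma dinner_ge0 d1 d2 (u : gridfun N 'M[R]_(d1, d2)) : 0 <= dinner len u u.
Proof.
rewrite mulr_ge0 //; first exact: ltW cell_volume_gt0.
by apply: sumr_ge0 => p _; exact: contract_ge0.
Qed.

Lemma dinner_eq0 d1 d2 (u : gridfun N 'M[R]_(d1, d2)) :
  dinner len u u = 0 -> u = 0.
Proof.
move/eqP; rewrite mulf_eq0 gt_eqF ?cell_volume_gt0 //= psumr_eq0; last first.
  by move=> p _; exact: contract_ge0.
move/allP => u0; apply/ffunP => p; rewrite ffunE; apply: contract_eq0.
by apply/eqP/(u0 p)/mem_index_enum.
Qed.

(** * The energy estimate for one implicit stage *)

(** Testing [k = G w] against [w], the argument of [G], turns the sign of [G]
    into [h (|A k|^2 + 2 |B k|^2) <= 0]. *)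
Lemma one_stage_homogeneous d d1 d2
    (G : gridfun N 'cV[R]_d -> gridfun N 'cV[R]_d)
    (A : {linear gridfun N 'cV[R]_d -> gridfun N 'M[R]_(d1, d2)})
    (At : {linear gridfun N 'M[R]_(d1, d2) -> gridfun N 'cV[R]_d})
    gP gD (h : R) (k : gridfun N 'cV[R]_d) :
  (forall u w, dinner len (A u) w = dinner len u (At w)) ->
  (forall v, dinner len v (G v) <= 0) ->
  0 < h ->
  k = G (h *: (At (A k) + coupling_adj gP gD (2 *: coupling gP gD k))) ->
  A k = 0 /\ coupling gP gD k = 0.
Proof.
move=> A_adj G_nsd h_gt0; set v := (At _ + _) => kE.
have := G_nsd (h *: v).
rewrite -kE dinnerC linearZ /= pmulr_rle0 // linearD /= -A_adj dinner_coupling_adj.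
set e := (X in _ + X).
have eE : e = cell_volume * 2 * \sum_p coupling gP gD k p ^+ 2.
  rewrite /e -[RHS]mulrA [in RHS]mulr_sumr; congr (_ * _); apply: eq_bigr => p _.
  by rewrite ffunE /GRing.scale /= -mulrA expr2.
have sum_ge0 : 0 <= \sum_p coupling gP gD k p ^+ 2.
  by apply: sumr_ge0 => p _; rewrite sqr_ge0.
have c_gt0 : 0 < cell_volume * 2 by rewrite mulr_gt0 ?cell_volume_gt0.
have e_ge0 : 0 <= e by rewrite eE mulr_ge0 // ltW.
move=> le0; have : dinner len (A k) (A k) + e == 0.
  by rewrite eq_le le0 addr_ge0 ?dinner_ge0.
rewrite paddr_eq0 ?dinner_ge0 // => /andP[/eqP/dinner_eq0 Ak0].
rewrite eE mulf_eq0 gt_eqF //= psumr_eq0 => [/allP k0|p _]; last exact: sqr_ge0.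
split=> //; apply/ffunP => p; rewrite [RHS]ffunE.
by have := k0 p (mem_index_enum p); rewrite /= sqrf_eq0 => /eqP.
Qed.

End DiscreteCalculus.

(** * Unique solvability of the scheme *)

Unset Implicit Arguments.
Set Strict Implicit.

Theorem theorem3p3 (R : realType) (m d : nat)
    (N : 'I_m -> nat) (len : 'I_m -> R)
    (N_gt0 : forall k, (0 < N k)%N) (len_gt0 : forall k, 0 < len k)
    (f : 'cV[R]_d -> 'M[R]_(d, m) -> R) (C : R)
    (f_bounded_below : exists B : R, forall y z, B <= f y z)
    (C_gt0 : 0 < C) (fC_gt0 : forall y z, 0 < f y z + C)
    (Lop Gop : {linear gridfun N 'cV[R]_d -> gridfun N 'cV[R]_d})
    (d1 d2 : nat)
    (A : {linear gridfun N 'cV[R]_d -> gridfun N 'M[R]_(d1, d2)})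
    (Astar : {linear gridfun N 'M[R]_(d1, d2) -> gridfun N 'cV[R]_d})
    (A_adj : forall u w, dinner len (A u) w = dinner len u (Astar w))
    (LopE : forall u, Lop u = Astar (A u))
    (Gop_nsd : forall v, dinner len v (Gop v) <= 0)
    (s : nat) (s_ge1 : (1 <= s)%N) (a : 'M[R]_s) (b : 'I_s -> R)
    (a_dirk : forall i j : 'I_s, (i < j)%N -> a i j = 0)
    (a_diag_gt0 : forall i : 'I_s, 0 < a i i)
    (dt : R) (dt_gt0 : 0 < dt) (n : nat)
    (PhiN : R -> gridfun N 'cV[R]_d)
    (Phin : gridfun N 'cV[R]_d) (qn : gridfun N R) :
  (exists! st : stage_values R N d s,
      leqrk_stages len f C Lop Gop a dt n PhiN Phin qn st) /\
  (exists! X : gridfun N 'cV[R]_d * gridfun N R,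
      leqrk_step len f C Lop Gop a b dt n PhiN Phin qn X).
Proof.
pose gP i := dg_dPhi len f C (PhiN (stage_time a dt n i)).
pose gD i := dg_dgradPhi len f C (PhiN (stage_time a dt n i)).
pose B i : {linear _ -> _} := coupling len (gP i) (gD i).
pose Bt i : {linear _ -> _} := coupling_adj len (gP i) (gD i).
have one_stage i h k : 0 < h ->
    k = stage_slope Gop Lop Bt i (h *: k) (h *: B i k) -> k = 0.
  rewrite /stage_slope scalerA mulrC -scalerA => h_gt0.
  rewrite [Lop (h *: k)]linearZ [Bt i (h *: _)]linearZ /= -scalerDr LopE => kE.
  have [Ak0 Bk0] := one_stage_homogeneous N_gt0 len_gt0 A_adj Gop_nsd h_gt0 kE.
  by rewrite kE Ak0 Bk0 scaler0 !linear0 addr0 scaler0 linear0.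
have [K [K_stages K_uniq]] := dirk_exists_unique a_dirk a_diag_gt0 dt_gt0 one_stage Phin qn.
(* The slopes determine the other stage values. *)
pose st := StageValues
  [ffun i => Phin + slope_sum a dt i K]
  [ffun i => qn + slope_sum a dt i (fun j => B j (K j))]
  K [ffun i => B i (K i)].
have st_unique st' : leqrk_stages len f C Lop Gop a dt n PhiN Phin qn st' -> st = st'.
  case: st' => Phi Q k l st'P.
  have PhiE i : Phi i = Phin + slope_sum a dt i k by case: (st'P i).
  have lE i : l i = B i (k i) by case: (st'P i).
  have QE i : Q i = qn + slope_sum a dt i (fun j => B j (k j)).
    case: (st'P i) => _ /= -> _ _; congr (_ + _ *: _).
    by apply: eq_bigr => j _; rewrite lE.
  have Kk : K = k.
    apply: K_uniq => i; rewrite /stage_slope -PhiE -QE.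
    by case: (st'P i) => _ _ kE _; rewrite [LHS]kE -addrA.
  by rewrite /st Kk; congr StageValues; apply/ffunP => i; rewrite ffunE ?PhiE ?QE ?lE.
have st_stages : leqrk_stages len f C Lop Gop a dt n PhiN Phin qn st.
  move=> i; split=> /=; rewrite !ffunE //.
  - by congr (_ + _ *: _); apply: eq_bigr => j _; rewrite ffunE.
  - by rewrite {1}K_stages -addrA.
split; first by exists st.
exists (Phin + dt *: \sum_i b i *: stk st i, qn + dt *: \sum_i b i *: stl st i).
split; first by exists st.
by move=> [Phi q] [st' [/st_unique <- /= -> ->]].
Qed.
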